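(* Let $p$ and $n$ be positive integers and let $A \in \mathrm{M}_n(\mathbb{C})$ be a nilpotent matrix. Then the set $A^{1/p} := \{X \in \mathrm{M}_n(\mathbb{C}) : X^p = A\}$ of all $p$-th roots of $A$ is path-connected.
   Context: $\mathrm{M}_n(\mathbb{C})$ denotes the space of $n \times n$ complex matrices with its usual topology as a finite-dimensional complex vector space, and $A^{1/p}$ carries the subspace topology. The set $A^{1/p}$ may be empty; path-connected means that any two points of the set are joined by a continuous path inside the set (so the empty set is allowed). *)

(* Defs.v *)
From HB Require Import structures.
From mathcomp Require Import all_boot all_order all_algebra.
From mathcomp Require Import all_classical all_reals all_analysis.
From mathcomp Require Import complex.

Set Implicit Arguments.
Unset Strict Implicit.
Unset Printing Implicit Defensive.

Import Order.TTheory GRing.Theory Num.Theory.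
Import numFieldNormedType.Exports.

Local Open Scope classical_set_scope.
Local Open Scope ring_scope.
Local Open Scope complex_scope.

(* MathComp-Analysis equips abstract [numFieldType]s with the topology of the  *)
(* norm, but canonical inference does not find it on the concrete type [R[i]]. *)
(* This transfers the norm topology of [R[i]^o] (balls for the modulus) to     *)
(* [R[i]], whence 'M[R[i]]_n gets the library's entrywise topology.            *)
HB.instance Definition _ (R : realType) :=
  NormedModule.copy R[i] (R[i]^o : normedModType R[i]).

(* [f] is total on [R], but only its restriction to [0, 1] matters. A path     *)
(* inside [S] for the subspace topology is the same as a path of [T] with      *)
(* values in [S]. The empty set is path-connected.                             *)
Definition path_connected (R : realType) (T : topologicalType) (S : set T) :=
  forall x y : T, S x -> S y ->
    exists f : R -> T,
      [/\ {within `[0, 1], continuous f}, f 0 = x, f 1 = y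
        & forall t, t \in `[0, 1] -> S (f t)].

Definition nilpotent_mx (K : pzRingType) (n : nat) (A : 'M[K]_n) :=
  exists k : nat, A ^+ k = 0.

Definition mxroots (K : pzRingType) (n p : nat) (A : 'M[K]_n) : set 'M[K]_n :=
  [set X | X ^+ p = A].

(* Main.v *)
(* Call N the index of a nilpotent X. A Jordan block of X of maximal size N
   splits off, X = J_N (+) X', so X^p = J_N^p (+) X'^p.

   Two p-th roots X, Y of A with the same index are linked as follows. The
   ranks of the powers of A determine those of X'^p and Y'^p, so X'^p and Y'^p
   are similar, and an element of the centralizer of A conjugates X to some
   J_N (+) X'' in the splitting of Y, with X''^p = Y'^p; then induct on the
   dimension. The invertible part of the centralizer is path-connected: it is
   the complement of a hypersurface in a complex vector space.

   If X has smaller index a than Y, write a = q p + r with r < p. Comparing the ranks of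
   X^(qp) = A^q = Y^(qp) gives X'^(qp) <> 0, so there is a row u with
   u X'^(qp) <> 0 = u X'^(qp+1). A line through X inside the set of roots then
   leads to a root of larger index: it moves the upper right corner of
   J_a (+) X' in the direction E + J_a C - C X', where E has last row u X'^(qp)
   and the rows u, u X'^p, u X'^(2p), ... of C, numbered from 0,
   stand at the places r, r + p, r + 2 p, ... *)
Require Import Defs.
From mathcomp Require Import all_boot all_order all_algebra.
From mathcomp Require Import all_classical all_reals all_analysis.
From mathcomp Require Import complex.
From mathcomp Require Import ring lra zify.
From Stdlib Require Import Relations.

Set Implicit Arguments.
Unset Strict Implicit.
Unset Printing Implicit Defensive.

Import Order.TTheory GRing.Theory Num.Theory.
Import numFieldNormedType.Exports.

Local Open Scope ring_scope.
Local Open Scope complex_scope.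

(** * Nilpotent matrices and their roots over a field *)

Section NilpotentRoots.
Variable K : fieldType.
Implicit Types m n k N : nat.

(** * Powers of matrices and similarity *)

Lemma mulmx_expr n (A : 'M[K]_n) k : A ^+ k *m A = A ^+ k.+1.
Proof. by rewrite exprSr. Qed.

Lemma expmx_intertwine m n (P : 'M[K]_(m, n)) (A : 'M[K]_n) (B : 'M[K]_m) k :
  P *m A = B *m P -> P *m A ^+ k = B ^+ k *m P.
Proof.
move=> PA; elim: k => [|k IHk]; first by rewrite !expr0 mulmx1 mul1mx.
by rewrite !exprSr mulmxA IHk -mulmxA PA mulmxA.
Qed.

Lemma expmx_diag_block m n (A : 'M[K]_m) (B : 'M[K]_n) k :
  block_mx A 0 0 B ^+ k = block_mx (A ^+ k) 0 0 (B ^+ k).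
Proof.
elim: k => [|k IHk]; first by rewrite !expr0 -scalar_mx_block.
by rewrite !exprSr IHk [LHS]mulmx_block !mulmx0 !mul0mx !addr0 !add0r.
Qed.

Lemma expmx_conj m n (P : 'M[K]_(m, n)) (Q : 'M[K]_(n, m)) (Z : 'M[K]_m) k :
  P *m Q = 1%:M -> Q *m P = 1%:M -> (Q *m Z *m P) ^+ k = Q *m Z ^+ k *m P.
Proof.
move=> PQ QP; have QZ : Q *m Z = (Q *m Z *m P) *m Q by rewrite -mulmxA PQ mulmx1.
by rewrite (expmx_intertwine k QZ) -[RHS]mulmxA QP mulmx1.
Qed.

(** The two sizes are independent, although invertibility forces them to agree: a matrix of size [n]
    can then be compared with a block matrix of size [N + (n - N)] without a cast. *)
Definition similar m n (A : 'M[K]_m) (B : 'M[K]_n) :=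
  exists (P : 'M[K]_(n, m)) (Q : 'M[K]_(m, n)),
    [/\ P *m Q = 1%:M, Q *m P = 1%:M & P *m A = B *m P].

Lemma similar_sym m n (A : 'M[K]_m) (B : 'M[K]_n) : similar A B -> similar B A.
Proof.
move=> [P [Q [PQ QP PA]]]; exists Q, P; split=> //.
by rewrite -[LHS]mulmx1 -PQ mulmxA -(mulmxA Q) -PA mulmxA QP mul1mx.
Qed.

Lemma similar_trans l m n (A : 'M[K]_l) (B : 'M[K]_m) (C : 'M[K]_n) :
  similar A B -> similar B C -> similar A C.
Proof.
move=> [P [Q [PQ QP PA]]] [P' [Q' [PQ' QP' PB]]].
exists (P' *m P), (Q *m Q'); split.
- by rewrite mulmxA -(mulmxA P') PQ mulmx1.
- by rewrite mulmxA -(mulmxA Q) QP' mulmx1.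
- by rewrite -mulmxA PA mulmxA PB mulmxA.
Qed.

Lemma similar_diag_block l m n (J : 'M[K]_l) (A : 'M[K]_m) (B : 'M[K]_n) :
  similar A B -> similar (block_mx J 0 0 A) (block_mx J 0 0 B).
Proof.
move=> [P [Q [PQ QP PA]]].
exists (block_mx 1%:M 0 0 P), (block_mx 1%:M 0 0 Q).
by split; rewrite !mulmx_block !mulmx0 !mul0mx !addr0 !add0r ?mul1mx ?mulmx1
  ?PQ ?QP ?PA -?scalar_mx_block.
Qed.

Lemma similar_rank m n (A : 'M[K]_m) (B : 'M[K]_n) k :
  similar A B -> \rank (A ^+ k) = \rank (B ^+ k).
Proof.
have half m' n' (A' : 'M[K]_m') (B' : 'M[K]_n') :
    similar A' B' -> (\rank (B' ^+ k) <= \rank (A' ^+ k))%N.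
  move=> [P [Q [PQ _ /expmx_intertwine-/(_ k) PA]]].
  rewrite -[B' ^+ k]mulmx1 -PQ mulmxA -PA.
  exact: leq_trans (mxrankM_maxl _ _) (mxrankM_maxr _ _).
by move=> sAB; apply/eqP; rewrite eqn_leq !half //; apply: similar_sym.
Qed.

(** * Ranks of the powers of a nilpotent matrix *)

Lemma exprmx_eq0W n (A : 'M[K]_n) k l : (k <= l)%N -> A ^+ k = 0 -> A ^+ l = 0.
Proof. by move=> /subnKC <- Ak; rewrite exprD Ak mul0r. Qed.

Lemma similar_exp_eq0 m n (A : 'M[K]_m) (B : 'M[K]_n) k :
  similar A B -> A ^+ k = 0 -> B ^+ k = 0.
Proof.
by move=> /similar_rank-/(_ k) rAB A0; apply/eqP; rewrite -mxrank_eq0 -rAB A0 mxrank0.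
Qed.

(** If the ranks were equal, the row spaces would be too, so [A ^+ k = U * A ^+ k.+1]; iterating
    this pushes the exponent past [N] and gives [A ^+ k = 0]. *)
Lemma nilp_rank_lt n (A : 'M[K]_n) N k :
  A ^+ N = 0 -> A ^+ k != 0 -> (\rank (A ^+ k.+1) < \rank (A ^+ k))%N.
Proof.
move=> AN Ak; rewrite ltn_neqAle exprS mxrankM_maxr andbT.
apply: contraNneq Ak => /eqP.
rewrite (mxrank_leqif_eq (submxMl A (A ^+ k))) => /andP[_ /submxP[U eU]].
have absorb j : exists V : 'M[K]_n, A ^+ k = V * A ^+ (k + j).
  elim: j => [|j [V eV]]; first by exists 1; rewrite addn0 mul1r.
  exists (V * U); rewrite [LHS]eV -mulrA; congr (_ * _).
  by rewrite addnS -addSn !exprD mulrA exprS; congr (_ * _); apply: eU.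
by have [V ->] := absorb N; rewrite exprD AN !mulr0.
Qed.

Lemma nilp_rank_ge n (A : 'M[K]_n) N a j :
  A ^+ N = 0 -> A ^+ a != 0 -> (j <= a)%N -> (a.+1 - j <= \rank (A ^+ j))%N.
Proof.
move=> AN Aa; move: {2}(a - j)%N (erefl (a - j)%N) => d.
elim: d j => [|d IHd] j dj ja.
  have -> : j = a by apply/eqP; rewrite eqn_leq ja -subn_eq0 dj.
  by rewrite subSnn lt0n mxrank_eq0.
have ja' : (j < a)%N by rewrite -subn_gt0 dj.
have := IHd j.+1; rewrite subnS dj => /(_ erefl ja').
rewrite subSS subSn // => /leq_ltn_trans; apply.
apply: (nilp_rank_lt AN); apply: contra_neq Aa.
exact: exprmx_eq0W.
Qed.

Lemma nilp_rank_le n (A : 'M[K]_n) N k : A ^+ N = 0 -> (\rank (A ^+ k) <= n - k)%N.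
Proof.
move=> AN; elim: k => [|k IHk]; first by rewrite subn0 rank_leq_row.
have [Ak|/(nilp_rank_lt AN) lt_r] := eqVneq (A ^+ k) 0.
  by rewrite exprS Ak mulr0 mxrank0.
by rewrite subnS -ltnS; apply: leq_trans lt_r (leq_trans IHk (leqSpred _)).
Qed.

Lemma nilp_expn n (A : 'M[K]_n) N : A ^+ N = 0 -> A ^+ n = 0.
Proof.
by move=> /nilp_rank_le-/(_ n); rewrite subnn leqn0 mxrank_eq0 => /eqP.
Qed.

Lemma nilp_index n (A : 'M[K]_n) N :
  A ^+ N = 0 -> (0 < n)%N -> exists2 a, (0 < a <= n)%N & A ^+ a = 0 /\ A ^+ a.-1 != 0.
Proof.
move=> AN n0; have ex0 : exists k, A ^+ k == 0 by exists N; apply/eqP.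
have [a /eqP Aa amin] := ex_minnP ex0.
have a0 : (0 < a)%N.
  case: a Aa {amin} => // /eqP; rewrite expr0 -mxrank_eq0 mxrank1.
  by rewrite eqn0Ngt n0.
exists a; first by rewrite a0 amin //; apply/eqP/(nilp_expn AN).
by split=> //; apply: contraTneq a0 => /eqP/amin; case: (a) => // b; rewrite ltnn.
Qed.

(** * Jordan blocks and the classification of nilpotent matrices by ranks *)

Definition rows_mx N n (f : nat -> 'rV[K]_n) : 'M[K]_(N, n) := \matrix_(i < N) f i.

Lemma eq_rows_mx N n (f g : nat -> 'rV[K]_n) :
  (forall i, (i < N)%N -> f i = g i) -> rows_mx N f = rows_mx N g.
Proof. by move=> fg; apply/row_matrixP => i; rewrite !rowK fg. Qed.

Lemma rows_mxM N m n (f : nat -> 'rV[K]_m) (B : 'M[K]_(m, n)) :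
  rows_mx N f *m B = rows_mx N (fun i => f i *m B).
Proof. by apply/row_matrixP => i; rewrite row_mul !rowK. Qed.

Lemma rows_mxD N n (f g : nat -> 'rV[K]_n) :
  rows_mx N f + rows_mx N g = rows_mx N (fun i => f i + g i).
Proof. by apply/row_matrixP => i; rewrite linearD /= !rowK. Qed.

(** The nilpotent Jordan block, with ones just above the diagonal. On [rows_mx N f], with [f] zero
    from [N] on, it acts as a plain shift of the index. *)
Definition shift_mx N : 'M[K]_N := \matrix_(i, j) (i.+1 == j)%:R.

Lemma shift_mx_rows N n (f : nat -> 'rV[K]_n) :
  f N = 0 -> shift_mx N *m rows_mx N f = rows_mx N (fun i => f i.+1).
Proof.
move=> fN; apply/row_matrixP => i; rewrite row_mul rowK mulmx_sum_row.
have [iN|] := ltnP i.+1 N.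
  rewrite (bigD1 (Ordinal iN)) //= !mxE eqxx scale1r rowK big1 ?addr0 // => j ji.
  rewrite !mxE; suff /negPf-> : i.+1 != j by rewrite scale0r.
  by apply: contraNneq ji => e; apply/eqP/val_inj; rewrite /= e.
move=> Ni; rewrite big1 => [|j _].
  by have -> : i.+1 = N by apply/eqP; rewrite eqn_leq ltn_ord.
by rewrite !mxE gtn_eqF ?scale0r // (leq_trans (ltn_ord j)).
Qed.

Lemma shift_mxX_rows N n (f : nat -> 'rV[K]_n) k :
  (forall i, (N <= i)%N -> f i = 0) ->
  shift_mx N ^+ k *m rows_mx N f = rows_mx N (fun i => f (i + k)%N).
Proof.
move=> fN; elim: k => [|k IHk].
  by rewrite expr0 mul1mx; apply: eq_rows_mx => i _; rewrite addn0.
rewrite exprS -mulmxA IHk shift_mx_rows ?fN ?leq_addr //.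
by apply: eq_rows_mx => i _; rewrite addSnnS.
Qed.

Lemma shift_mx_nilp N : shift_mx N ^+ N = 0.
Proof.
rewrite -[LHS]mulmx1.
(* The rows of the identity, continued by zero; [N] shifts leave only zero rows. *)
pose f i : 'rV[K]_N := if insub i is Some j then row j 1%:M else 0.
have -> : 1%:M = rows_mx N f.
  by apply/row_matrixP => i; rewrite rowK /f valK.
have f0 i : (N <= i)%N -> f i = 0 by move=> Ni; rewrite /f insubN // -leqNgt.
rewrite shift_mxX_rows //; apply/row_matrixP => i.
by rewrite rowK row0 f0 // leq_addl.
Qed.

(** Fix a nonzero entry [(i, j)] of [A ^+ N.-1]. The rows [i] of the powers of [A] span an invariant
    space on which [A] acts as the Jordan block. The columns [j], in reverse order, form [C];
    [R *m C] is triangular with that nonzero entry all along its diagonal, so the left kernel of [C]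
    is an invariant complement. *)
Lemma nilp_split n (A : 'M[K]_n) N : A ^+ N = 0 -> A ^+ N.-1 != 0 ->
  exists A' : 'M[K]_(n - N), similar A (block_mx (shift_mx N) 0 0 A').
Proof.
move=> AN AN1.
have [N0|N0] := posnP N; first by rewrite -AN N0 eqxx in AN1.
have /matrix0Pn[i [j Aij]] := AN1.
pose R := rows_mx N (fun k => row i (A ^+ k)).
pose C := \matrix_(k < n, l < N) (A ^+ (N.-1 - l)) k j.
have RCE (k l : 'I_N) : (R *m C) k l = (A ^+ (k + (N.-1 - l))) i j.
  by rewrite exprD !mxE; apply: eq_bigr => t _; rewrite !mxE.
have RC_unit : R *m C \in unitmx.
  rewrite unitmxE -det_tr det_trig.
    rewrite unitfE; apply/prodf_neq0 => k _.
    by rewrite mxE RCE subnKC // -ltnS prednK.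
  apply/is_trig_mxP => k l kl; rewrite mxE RCE.
  by rewrite (exprmx_eq0W _ AN) ?mxE //; have := ltn_ord l; lia.
have AC : A *m C = C *m shift_mx N.
  apply/matrixP => k l; have -> : (A *m C) k l = (A ^+ (N - l)) k j.
    have -> : (N - l = (N.-1 - l).+1)%N by have := ltn_ord l; lia.
    by rewrite exprS !mxE; apply: eq_bigr => t _; rewrite mxE.
  rewrite mxE; case: l => [[|l] lN].
    by rewrite subn0 AN mxE big1 // => t _; rewrite [shift_mx _ _ _]mxE mulr0.
  rewrite (bigD1 (Ordinal (ltnW lN))) //= big1 => [|t tl].
    rewrite !mxE eqxx mulr1 addr0; congr ((A ^+ _) k j) => /=; lia.
  rewrite !mxE eqSS; suff /negPf-> : t != l :> nat by rewrite mulr0.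
  by apply: contraNneq tl => e; apply/eqP/val_inj.
have RA : R *m A = shift_mx N *m R.
  rewrite rows_mxM shift_mx_rows ?AN ?row0 //.
  by apply: eq_rows_mx => k _; rewrite -row_mul mulmx_expr.
have rC : \rank C = N.
  apply/eqP; rewrite eqn_leq rank_leq_col.
  by rewrite -[X in (X <= _)%N](mxrank_unit RC_unit) mxrankM_maxr.
have Nn : (N <= n)%N by rewrite -rC rank_leq_row.
have [W [/row_freeP[V WV] WC AW]] : exists W : 'M[K]_(n - N, n),
    [/\ row_free W, W *m C = 0 & (W *m A <= W)%MS].
  have <- : \rank (kermx C) = (n - N)%N by rewrite mxrank_ker rC.
  have WC : row_base (kermx C) *m C = 0 by apply/sub_kermxP; rewrite eq_row_base.
  exists (row_base (kermx C)); split=> //; first exact: row_base_free.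
  by rewrite eq_row_base; apply/sub_kermxP; rewrite -mulmxA AC mulmxA WC mul0mx.
have [A' WA] := submxP AW.
exists A', (col_mx R W).
pose Ri := C *m invmx (R *m C).
have RRi : R *m Ri = 1%:M by rewrite mulmxA mulmxV.
have WRi : W *m Ri = 0 by rewrite mulmxA WC mul0mx.
(* The right inverse [V] of [W] is corrected so that [R] kills it; since [W *m Ri = 0], it stays a
   right inverse of [W]. *)
clearbody Ri; pose Q := row_mx Ri ((1%:M - Ri *m R) *m V).
have PQ : col_mx R W *m Q = 1%:M.
  rewrite mul_col_row RRi WRi !mulmxA !mulmxBr !mulmx1 !mulmxA RRi WRi.
  by rewrite mul1mx mul0mx subrr subr0 mul0mx WV -scalar_mx_block.
exists Q; split=> //.
  clearbody Q; move: (col_mx R W) Q PQ; rewrite subnKC // => P Q.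
  exact: mulmx1C.
by rewrite mul_col_mx mul_block_col RA WA !mul0mx addr0 add0r.
Qed.

(** Equal ranks give equal sizes ([k = 0]) and equal indices. The same Jordan block splits off both
    matrices, and subtracting its ranks leaves complements with equal ranks, to which induction on
    the size applies. *)
Lemma similar_of_rank m n (A : 'M[K]_m) (B : 'M[K]_n) N : A ^+ N = 0 ->
  (forall k, \rank (A ^+ k) = \rank (B ^+ k)) -> similar A B.
Proof.
have [s] := ubnP m; elim: s => // s IHs in m n A B *.
rewrite ltnS => ms AN rAB.
have emn : m = n by have := rAB 0; rewrite !expr0 !mxrank1.
subst n.
have eq0 k : (A ^+ k == 0) = (B ^+ k == 0) by rewrite -!mxrank_eq0 rAB.
have [m0|m0] := posnP m.
  by exists 0, 0; split; subst m; rewrite ?[LHS]thinmx0 ?[RHS]thinmx0.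
have [a /andP[a0 am] [Aa Aa1]] := nilp_index AN m0.
have [A' sA] := nilp_split Aa Aa1.
have [B' sB] : exists B' : 'M[K]_(m - a), similar B (block_mx (shift_mx a) 0 0 B').
  by apply: nilp_split; [apply/eqP; rewrite -eq0 Aa | rewrite -eq0].
have sAB' : similar A' B'.
  apply: IHs.
  - by apply: leq_trans ms; rewrite ltn_subrL a0.
  - have := similar_exp_eq0 sA AN.
    rewrite expmx_diag_block -[X in _ = X]block_mx0.
    by case/eq_block_mx.
  - move=> k; have := rAB k; rewrite (similar_rank k sA) (similar_rank k sB).
    by rewrite !expmx_diag_block !rank_diag_block_mx => /addnI.
exact: similar_trans (similar_trans sA (similar_diag_block _ sAB')) (similar_sym sB).
Qed.

Lemma expmx_corner m n (J : 'M[K]_m) (B : 'M[K]_n) (E C : 'M[K]_(m, n)) t k :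
  E *m B = 0 ->
  block_mx J (t *: (E + J *m C - C *m B)) 0 B ^+ k.+1 =
  block_mx (J ^+ k.+1) (t *: (J ^+ k *m E + J ^+ k.+1 *m C - C *m B ^+ k.+1))
    0 (B ^+ k.+1).
Proof.
move=> EB; elim: k => [|k IHk]; first by rewrite !expr0 mul1mx !expr1.
rewrite exprSr IHk [LHS]mulmx_block !mulmx0 !mul0mx !addr0 !add0r !mulmx_expr.
congr (block_mx _ _ _ _).
rewrite -scalemxAr -scalemxAl -scalerDr; congr (_ *: _).
rewrite mulmxBr mulmxDr mulmxBl mulmxDl -[J ^+ k *m E *m B]mulmxA EB mulmx0 add0r.
rewrite (mulmxA _ J C) (mulmxA _ C B) -[C *m _ *m B]mulmxA !mulmx_expr.
by rewrite addrA subrK.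
Qed.

Lemma root_deformation n p (X Y : 'M[K]_n) a N :
  (0 < p)%N -> X ^+ p = Y ^+ p -> Y ^+ N = 0 -> X ^+ a = 0 -> X ^+ a.-1 != 0 ->
  Y ^+ a != 0 ->
  exists2 D, forall t, (X + t *: D) ^+ p = X ^+ p & (X + D) ^+ a != 0.
Proof.
move=> p0 XYp YN Xa Xa1 Ya.
have [a0|a0] := posnP a; first by rewrite -Xa a0 eqxx in Xa1.
pose q := (a %/ p)%N; pose r := (a %% p)%N.
have aE : a = (q * p + r)%N := divn_eq a p.
have rp : (r < p)%N by rewrite ltn_mod.
have XYpq : X ^+ (q * p) = Y ^+ (q * p) by rewrite mulnC !exprM XYp.
(* If [p] divided [a], both [a]-th powers would be the same power of the common [p]-th power, so
   [Y ^+ a = X ^+ a = 0]. *)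
have r0 : (0 < r)%N.
  rewrite lt0n; apply: contra_neq Ya => r0.
  by rewrite aE r0 addn0 -XYpq -[X in X ^+ _]/X -Xa aE r0 addn0.
have [X' [P [Q [PQ QP PX]]]] := nilp_split Xa Xa1.
set m := (n - a)%N in X' P Q PQ QP PX.
have sX : similar X (block_mx (shift_mx a) 0 0 X') by exists P, Q.
have [J0 X'a] : shift_mx a ^+ a = 0 /\ X' ^+ a = 0.
  have := similar_exp_eq0 sX Xa.
  by rewrite expmx_diag_block -[X in _ = X]block_mx0; case/eq_block_mx.
(* As [Y ^+ a != 0], the common power has rank at least [a + 1 - q * p], while the Jordan block
   contributes at most [a - q * p]. *)
have X'pq : X' ^+ (q * p) != 0.
  have pqa : (q * p <= a)%N by rewrite aE leq_addr.
  have := nilp_rank_ge YN Ya pqa; rewrite -XYpq (similar_rank _ sX).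
  rewrite expmx_diag_block rank_diag_block_mx -mxrank_eq0 -lt0n.
  have := nilp_rank_le (q * p) J0; lia.
(* Let [q * p + k.+1] be the first exponent from [q * p] on at which [X'] vanishes; a suitable row
   of [X' ^+ k] serves as [u]. *)
have [u u_n0 uX] : exists2 u : 'rV_m, u *m X' ^+ (q * p) != 0 & u *m X' ^+ (q * p).+1 = 0.
  have exk : exists k, X' ^+ (q * p + k) == 0 by exists r; rewrite -aE X'a.
  have [k /eqP X'k kmin] := ex_minnP exk.
  case: k X'k kmin => [|k] X'k kmin.
    by rewrite addn0 in X'k; rewrite X'k eqxx in X'pq.
  have /matrix0Pn[i [j X'ij]] : X' ^+ (q * p + k) != 0.
    by apply: contraT; rewrite negbK => /kmin; rewrite ltnn.
  exists (row i (X' ^+ k)); rewrite -row_mul -[X in row _ X]exprD addnC.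
    by apply: contraNneq X'ij => /rowP/(_ j); rewrite !mxE => ->.
  by rewrite addSnnS X'k row0.
pose f := u *m X' ^+ (q * p).
have fX' : f *m X' = 0 by rewrite -mulmxA mulmx_expr.
pose e i : 'rV_m := if i == a.-1 then f else 0.
pose c i : 'rV_m :=
  if (i < a)%N && (i %% p == r)%N then u *m X' ^+ (i %/ p * p) else 0.
pose E := rows_mx a e; pose C := rows_mx a c.
have e0 i : (a <= i)%N -> e i = 0.
  by move=> ai; rewrite /e ifN // -(ltn_predK a0) gtn_eqF // (leq_trans _ ai) ?prednK.
have c0 i : (a <= i)%N -> c i = 0 by move=> ai; rewrite /c ltnNge ai.
have EX' : E *m X' = 0.
  rewrite rows_mxM; apply/row_matrixP => i; rewrite rowK row0 /e.
  by case: ifP => _; rewrite ?fX' ?mul0mx.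
(* Row by row, [c (i + p)] equals [c i *m X' ^+ p], except at [i = a - p]: there the shift runs out
   of [C], and the last row [f] of [E] supplies the missing [u *m X' ^+ (q * p)]. *)
have corner_p : shift_mx a ^+ p.-1 *m E + shift_mx a ^+ p *m C - C *m X' ^+ p = 0.
  apply/eqP; rewrite subr_eq0; apply/eqP.
  rewrite !shift_mxX_rows // rows_mxD rows_mxM; apply: eq_rows_mx => i ia.
  have [ir|ir] := eqVneq (i %% p)%N r; last first.
    have -> : c i = 0 by rewrite /c (negPf ir) andbF.
    have -> : c (i + p)%N = 0 by rewrite /c modnDr (negPf ir) andbF.
    rewrite /e ifN ?addr0 ?mul0mx //; apply: contraNneq ir => ipa.
    by rewrite /r (_ : a = (i + p)%N) ?modnDr //; lia.
  have iE : i = (i %/ p * p + r)%N by rewrite -ir -divn_eq.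
  have lt_iq : (i %/ p < q)%N by rewrite -(ltn_pmul2r p0); lia.
  have -> : c i = u *m X' ^+ (i %/ p * p) by rewrite /c ia ir eqxx.
  rewrite -mulmxA -[X' ^+ _ *m X' ^+ p]exprD -mulSnr.
  have [ipa|ipa] := ltnP (i + p) a.
    have -> : e (i + p.-1)%N = 0 by rewrite /e ifN //; apply/eqP; lia.
    by rewrite /c ipa modnDr ir eqxx add0r divnDr // divnn p0 addn1.
  have qE : (i %/ p).+1 = q.
    by apply/eqP; rewrite eqn_leq lt_iq -(leq_pmul2r p0); lia.
  have -> : e (i + p.-1)%N = f.
    by rewrite /e ifT //; apply/eqP; rewrite -qE in aE; lia.
  by rewrite c0 // addr0 qE.
pose D := E + shift_mx a *m C - C *m X'.
have XQP : X = Q *m block_mx (shift_mx a) 0 0 X' *m P.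
  by rewrite -mulmxA -PX mulmxA QP mul1mx.
have XtD t : X + t *: (Q *m block_mx 0 D 0 0 *m P) =
    Q *m block_mx (shift_mx a) (t *: D) 0 X' *m P.
  rewrite {1}XQP scalemxAl scalemxAr -mulmxDl -mulmxDr scale_block_mx add_block_mx.
  by rewrite !scaler0 !addr0 add0r.
exists (Q *m block_mx 0 D 0 0 *m P).
  move=> t; rewrite XtD (expmx_conj _ _ PQ QP) -(prednK p0).
  rewrite expmx_corner // prednK // corner_p scaler0.
  by rewrite -expmx_diag_block -(expmx_conj _ _ PQ QP) -XQP.
(* In the [a]-th power the terms with [C] vanish; the corner is [shift_mx a ^+ a.-1 *m E], whose row
   0 is the nonzero [f]. *)
have := expmx_corner (shift_mx a) C 1 a.-1 EX'; rewrite prednK // => corner_a.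
rewrite -[_ *m P]scale1r XtD (expmx_conj _ _ PQ QP) corner_a.
rewrite J0 X'a mul0mx mulmx0 subr0 addr0 scale1r.
apply: contraNneq u_n0 => /(congr1 (fun Z => P *m Z *m Q)).
rewrite mulmx0 mul0mx !mulmxA PQ mul1mx -mulmxA PQ mulmx1 -[X in _ = X]block_mx0.
case/eq_block_mx => _ + _ _; rewrite shift_mxX_rows // => /row_matrixP.
by move/(_ (Ordinal a0)); rewrite rowK row0 add0n /e eqxx => /eqP.
Qed.

(** * Chains of elementary moves between roots *)

(** An algebraic stand-in for paths, available over any field: over the complex numbers each move is
    later realized by a path of roots. *)
Inductive root_step n p (A : 'M[K]_n) : 'M[K]_n -> 'M[K]_n -> Prop :=
| RootStepConj g h X of X ^+ p = A & g *m h = 1%:M & g *m A = A *m g :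
    root_step p A X (g *m X *m h)
| RootStepLine (X D : 'M[K]_n) of (forall t : K, (X + t *: D) ^+ p = A) :
    root_step p A X (X + D).

Definition root_chain n p (A : 'M[K]_n) := clos_refl_sym_trans _ (root_step p A).

(** Lifts the chains found by induction on the dimension: a conjugating [g] is extended by an
    identity block, a direction [D] by a zero block. *)
Lemma root_chain_diag_block n m N p (P : 'M[K]_(N + m, n)) (Q : 'M[K]_(n, N + m))
    (J : 'M[K]_N) (B X Y : 'M[K]_m) :
  P *m Q = 1%:M -> Q *m P = 1%:M -> root_chain p B X Y ->
  root_chain p (Q *m block_mx (J ^+ p) 0 0 B *m P)
    (Q *m block_mx J 0 0 X *m P) (Q *m block_mx J 0 0 Y *m P).
Proof.
move=> PQ QP.
have conjM (Z T : 'M[K]_(N + m)) : (Q *m Z *m P) *m (Q *m T *m P) = Q *m (Z *m T) *m P.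
  by rewrite !mulmxA -(mulmxA (Q *m Z)) PQ mulmx1.
elim=> {X Y} [X Y [g h {}X XB gh gB|{}X D XD]|X|X Y _ IH|X Y Z _ IHX _ IHY].
- have -> : Q *m block_mx J 0 0 (g *m X *m h) *m P =
      (Q *m block_mx 1%:M 0 0 g *m P) *m (Q *m block_mx J 0 0 X *m P)
        *m (Q *m block_mx 1%:M 0 0 h *m P).
    by rewrite !conjM !mulmx_block !mulmx0 !mul0mx !addr0 !add0r !mul1mx !mulmx1 mul0mx.
  apply: rst_step; constructor.
  + by rewrite (expmx_conj _ _ PQ QP) expmx_diag_block XB.
  + rewrite conjM mulmx_block !mulmx0 !mul0mx !addr0 !add0r mul1mx gh.
    by rewrite -scalar_mx_block mulmx1.
  + by rewrite !conjM !mulmx_block !mulmx0 !mul0mx !addr0 !add0r mul1mx mulmx1 gB.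
- have lineE t : Q *m block_mx J 0 0 X *m P + t *: (Q *m block_mx 0 0 0 D *m P) =
      Q *m block_mx J 0 0 (X + t *: D) *m P.
    rewrite scalemxAl scalemxAr -mulmxDl -mulmxDr scale_block_mx add_block_mx.
    by rewrite !scaler0 !addr0.
  have := lineE 1; rewrite !scale1r => <-; apply: rst_step; constructor => t.
  by rewrite lineE (expmx_conj _ _ PQ QP) expmx_diag_block XD.
- exact: rst_refl.
- exact: rst_sym.
- exact: rst_trans IHX IHY.
Qed.

(** A matrix intertwining two roots also intertwines their [p]-th powers, which are both [A]; so it
    lies in the centralizer of [A]. *)
Lemma root_chain_similar n p (A X Z : 'M[K]_n) :
  similar X Z -> X ^+ p = A -> Z ^+ p = A -> root_chain p A X Z.
Proof.
move=> [g [h [gh _ gX]]] XA ZA.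
have -> : Z = g *m X *m h by rewrite gX -mulmxA gh mulmx1.
by apply: rst_step; constructor; rewrite // -{1}XA -ZA; apply: expmx_intertwine.
Qed.

Lemma similar_conj m n (P : 'M[K]_(m, n)) (Q : 'M[K]_(n, m)) (Z : 'M[K]_m) :
  P *m Q = 1%:M -> Q *m P = 1%:M -> similar Z (Q *m Z *m P).
Proof. by move=> PQ QP; exists Q, P; split=> //; rewrite -mulmxA PQ mulmx1. Qed.

Lemma root_chain_same_index n p (X Y : 'M[K]_n) a :
    (forall m, (m < n)%N -> forall Z T : 'M[K]_m, Z ^+ p = T ^+ p ->
      Z ^+ a = 0 -> T ^+ a = 0 -> root_chain p (T ^+ p) Z T) ->
    (0 < p)%N -> (0 < a <= n)%N -> X ^+ p = Y ^+ p ->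
    X ^+ a = 0 -> X ^+ a.-1 != 0 -> Y ^+ a = 0 -> Y ^+ a.-1 != 0 ->
  root_chain p (Y ^+ p) X Y.
Proof.
move=> IH p0 /andP[a0 an] XYp Xa Xa1 Ya Ya1.
have [X' sX] := nilp_split Xa Xa1; have [Y' sY] := nilp_split Ya Ya1.
have nil (Z : 'M[K]_n) (Z' : 'M[K]_(n - a)) :
    similar Z (block_mx (shift_mx a) 0 0 Z') -> Z ^+ a = 0 -> Z' ^+ a = 0.
  move=> sZ /(similar_exp_eq0 sZ).
  by rewrite expmx_diag_block -[X in _ = X]block_mx0; case/eq_block_mx.
have [X'a Y'a] := (nil _ _ sX Xa, nil _ _ sY Ya).
have [||S [S' [SS' S'S SX]]] := @similar_of_rank _ _ (X' ^+ p) (Y' ^+ p) a.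
- by rewrite -exprM mulnC exprM X'a expr0n gtn_eqF.
- move=> k; have := similar_rank (p * k) sX.
  rewrite exprM XYp -exprM (similar_rank (p * k) sY) !expmx_diag_block.
  by rewrite !rank_diag_block_mx -!exprM => /addnI.
(* Conjugation by [S] turns [X'] into a root of [Y' ^+ p], so that the induction hypothesis compares
   it with [Y']. *)
pose X'' := S *m X' *m S'.
have X''p : X'' ^+ p = Y' ^+ p.
  by rewrite (expmx_conj _ _ S'S SS') SX -mulmxA SS' mulmx1.
have X''a : X'' ^+ a = 0 by rewrite (expmx_conj _ _ S'S SS') X'a mulmx0 mul0mx.
have lt_na : (n - a < n)%N by rewrite ltn_subrL a0 (leq_trans a0).
have chain := IH _ lt_na _ _ X''p X''a Y'a.
have [P [Q [PQ QP PY]]] := sY.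
have YE : Q *m block_mx (shift_mx a) 0 0 Y' *m P = Y.
  by rewrite -mulmxA -PY mulmxA QP mul1mx.
have YpE : Q *m block_mx (shift_mx a ^+ p) 0 0 (Y' ^+ p) *m P = Y ^+ p.
  by rewrite -expmx_diag_block -(expmx_conj _ _ PQ QP) YE.
have := root_chain_diag_block (shift_mx a) PQ QP chain.
rewrite YE YpE; apply: rst_trans; apply: root_chain_similar => //.
  apply: similar_trans sX (similar_trans _ (similar_conj _ PQ QP)).
  exact/similar_diag_block/similar_conj.
by rewrite (expmx_conj _ _ PQ QP) expmx_diag_block X''p YpE.
Qed.

Lemma root_chain_nilp n p (X Y : 'M[K]_n) N : (0 < p)%N ->
  X ^+ p = Y ^+ p -> X ^+ N = 0 -> Y ^+ N = 0 -> root_chain p (Y ^+ p) X Y.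
Proof.
move=> p0; have [s] := ubnP n; elim: s => // s IHs in n X Y N *.
rewrite ltnS => ns.
have [n0|n0] := posnP n.
  by subst n => _ _ _; rewrite (_ : X = Y) ?[X]thinmx0 ?[Y]thinmx0 //; apply: rst_refl.
move=> XYp /nilp_expn Xn /nilp_expn Yn {N}.
have [a /andP[a0 an] [Xa Xa1]] := nilp_index Xn n0.
have [b /andP[b0 bn] [Yb Yb1]] := nilp_index Yn n0.
(* Inner induction on how far the two indices are from [n]: equal indices are settled by the smaller
   dimensions, and otherwise the deformation raises the smaller index. *)
have [d] := ubnP ((n - a) + (n - b)).
elim: d => // d IHd in X Y a b XYp Xn Yn a0 an b0 bn Xa Xa1 Yb Yb1 *.
rewrite ltnS => abd.
wlog ab : X Y a b XYp Xn Yn a0 an b0 bn Xa Xa1 Yb Yb1 abd / (a <= b)%N.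
  move=> W; have [ab|/ltnW ba] := leqP a b; first exact: (W X Y a b).
  apply: rst_sym; rewrite -XYp; apply: (W Y X b a) => //.
  by rewrite addnC.
have [ab'|ab'] := eqVneq a b.
  subst b; apply: (root_chain_same_index (a := a)) => //; first last.
    by rewrite a0.
  move=> m mn Z T ZT Za Ta; apply: (IHs _ _ _ a) => //.
  exact: leq_trans mn ns.
have {ab ab'} ab : (a < b)%N by rewrite ltn_neqAle ab'.
have Ya : Y ^+ a != 0.
  apply: contra_neq Yb1; apply: exprmx_eq0W; lia.
have [D XD XDa] := root_deformation p0 XYp Yn Xa Xa1 Ya.
have XDp : (X + D) ^+ p = Y ^+ p by rewrite -XYp -(XD 1) scale1r.
apply: (rst_trans _ _ _ (X + D)).
  by apply: rst_step; constructor => t; rewrite XD.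
have XDn : (X + D) ^+ n = 0.
  apply: (@nilp_expn _ _ (p * n)).
  by rewrite exprM XDp -exprM mulnC exprM Yn expr0n gtn_eqF.
have [c /andP[c0 cn] [XDc XDc1]] := nilp_index XDn n0.
apply: (IHd _ _ c b) => //; apply: leq_trans abd.
suff : (a < c)%N by lia.
by rewrite ltnNge; apply: contra XDa => ca; rewrite (exprmx_eq0W ca).
Qed.

End NilpotentRoots.

(** * Paths *)

Local Open Scope classical_set_scope.

(** * Continuity of rational functions and of matrix-valued maps *)

Lemma continuous_horner_fraction (K : numFieldType) (T : topologicalType)
    (z : T -> K) (q d : {poly K}) :
  continuous z -> (forall t, d.[z t] != 0) ->
  continuous (fun t => q.[z t] / d.[z t]).
Proof.
move=> cz dz t.
have cp (p : {poly K}) : p.[z x] @[x --> t] --> p.[z t].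
  elim/poly_ind: p => [|p c IHp].
    by under eq_fun do rewrite horner0; rewrite horner0; exact: cvg_cst.
  under eq_fun do rewrite hornerMXaddC; rewrite hornerMXaddC.
  by apply: cvgD; [apply: cvgM; [exact: IHp|exact: cz]|exact: cvg_cst].
by apply: cvgM; [exact: cp|apply: cvgV; [exact: dz|exact: cp]].
Qed.

Lemma continuous_mx (T U : topologicalType) m n (f : T -> 'M[U]_(m, n)) :
  (forall i j, continuous (fun t => f t i j)) -> continuous f.
Proof.
move=> cf t A [P MP sPA].
have : \forall x \near t, forall i j, P i j (f x i j).
  apply: filter_forall => i; apply: filter_forall => j.
  exact: cf (MP i j).
by apply: filterS => x Px; apply: sPA.
Qed.

Lemma continuous_real_complex (R : realType) : continuous (real_complex R : R -> R[i]).
Proof.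
move=> x; apply/cvgrPdist_lt => e e0.
have [r er] : exists r, e = r%:C by apply/complex_realP/gtr0_real.
rewrite er -[0]/(0%:C) ltcR in e0 *.
near=> y.
have -> : `|x%:C - y%:C| = `|x - y|%:C :> R[i].
  by rewrite -rmorphB /= normc_def /= expr0n /= addr0 sqrtr_sqr.
rewrite ltcR; near: y; exact: cvgr_dist_lt.
Unshelve. all: by end_near. Qed.

(** * Realizing chains of roots by paths *)

Section RootPaths.
Variable R : realType.
Implicit Types n p : nat.

(* Paths defined on the whole line with all values in S: gluing then needs no
   side conditions on the domain. *)
Definition joined n (S : set 'M[R[i]]_n) (X Y : 'M[R[i]]_n) :=
  exists f : R -> 'M[R[i]]_n,
    [/\ forall i j, continuous (fun t => f t i j), f 0 = X, f 1 = Y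
      & forall t, S (f t)].

Lemma joined_sym n (S : set 'M[R[i]]_n) X Y : joined S X Y -> joined S Y X.
Proof.
move=> [f [cf f0 f1 Sf]]; exists (fun t => f (1 - t)).
split; [|by rewrite subr0|by rewrite subrr|by move=> t].
move=> i j t; apply: (@continuous_comp _ _ _ (fun t : R => 1 - t) (fun t => f t i j)).
  by apply: cvgB; [exact: cvg_cst|exact: cvg_id].
exact: cf.
Qed.

Lemma joined_trans n (S : set 'M[R[i]]_n) X Y Z :
  joined S X Y -> joined S Y Z -> joined S X Z.
Proof.
move=> [f [cf f0 f1 Sf]] [g [cg g0 g1 Sg]].
(* Concatenation by a single continuous formula: on each side of [t = 1/2] one of the two terms is
   constantly [Y] and cancels. *)
pose h t := f (Num.min (2 * t) 1) + g (Num.max (2 * t - 1) 0) - Y.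
have c2 : continuous (fun t : R => 2 * t).
  by move=> t; apply: cvgM; [exact: cvg_cst|exact: cvg_id].
have hE t : h t = if t <= 2^-1 then f (2 * t) else g (2 * t - 1).
  rewrite /h; case: ifPn => [t2|]; last rewrite -ltNge => t2.
    by rewrite min_l ?max_r ?g0 ?addrK //; lra.
  by rewrite min_r ?max_l ?f1 1?addrC ?addKr //; lra.
exists h; split.
- move=> i j t; rewrite /h.
  rewrite (_ : (fun t => _) = fun t => f (Num.min (2 * t) 1) i j +
    g (Num.max (2 * t - 1) 0) i j - Y i j).
    apply: cvgB; last exact: cvg_cst.
    apply: cvgD.
      apply: (@continuous_comp _ _ _ (fun t : R => Num.min (2 * t) 1)
        (fun t => f t i j)); last exact: cf.
      by apply: continuous_min; [exact: c2|exact: cvg_cst].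
    apply: (@continuous_comp _ _ _ (fun t : R => Num.max (2 * t - 1) 0)
      (fun t => g t i j)); last exact: cg.
    apply: continuous_max; last exact: cvg_cst.
    by apply: cvgB; [exact: c2|exact: cvg_cst].
  by apply/funext => s; rewrite !mxE.
- by rewrite hE ifT ?mulr0 // invr_ge0 ler0n.
- by rewrite hE ifF; [rewrite mulr1 -g1; congr g; ring | apply/negbTE; rewrite -ltNge; lra].
- by move=> t; rewrite hE; case: ifP.
Qed.

(** Meant for [P] a determinant along a complex line of matrices: it has finitely many zeros, and
    the parameter goes around them. With [u] a polynomial, matrix entries and inverses along the
    path stay rational in [t]. *)
Lemma polynomial_path_avoiding (P : {poly R[i]}) : P.[0] != 0 -> P.[1] != 0 ->
  exists u : {poly R[i]}, [/\ u.[0] = 0, u.[1] = 1 & forall t : R, P.[u.[t%:C]] != 0].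
Proof.
move=> P0 P1.
have [rs PE] := closed_field_poly_normal P.
(* The parabola t + i c t (1 - t), t real, passes through a given z outside
   {0, 1} for at most one c, namely [height z]. *)
pose height (z : R[i]) := complex.Im z / (complex.Re z * (1 - complex.Re z)).
(* Strictly above the height of every root, so no root lies on the parabola. *)
pose c := 1 + \sum_(z <- rs) `|height z|.
pose u : {poly R[i]} := 'X + (c%:C * 'i)%:P * ('X * (1 - 'X)).
have uE z : u.[z] = z + c%:C * 'i * (z * (1 - z)) by rewrite !hornerE.
have u0 : u.[0] = 0 by rewrite uE mul0r mulr0 addr0.
have u1 : u.[1] = 1 by rewrite uE subrr !mulr0 addr0.
exists u; split=> // t; apply/negP => Put.
have ut : u.[t%:C] = t +i* (c * (t * (1 - t))).
  by rewrite uE -[1 - t%:C]/(1%:C - t%:C); simpc.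
have t01 : t * (1 - t) != 0.
  apply/negP; rewrite mulf_eq0 subr_eq0 => /orP[] /eqP te; move: Put.
    by rewrite te u0; apply/negP.
  by rewrite -te u1; apply/negP.
have : u.[t%:C] \in rs.
  have lc0 : lead_coef P != 0.
    by rewrite lead_coef_eq0; apply: contraNneq P0 => ->; rewrite horner0.
  by move: Put; rewrite -[_ == 0]/(root P _) PE rootZ // root_prod_XsubC.
move=> u_rs.
have ch : c = height u.[t%:C] by rewrite /height ut /= mulfK.
have : `|height u.[t%:C]| < c.
  rewrite ltr_pwDl // (big_rem _ u_rs) /= lerDl.
  by apply: sumr_ge0 => z _; exact: normr_ge0.
by rewrite -ch ltNge ler_norm.
Qed.

Lemma joined_centralizer n p (A X g h : 'M[R[i]]_n) :
  X ^+ p = A -> g *m h = 1%:M -> g *m A = A *m g ->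
  joined (mxroots p A) X (g *m X *m h).
Proof.
move=> XA gh gA.
(* The line from the identity to [g] stays in the centralizer of [A]. Over the polynomial ring,
   [v = 'X] gives the determinant to be avoided and [v = u] the path itself. *)
pose M (v : {poly R[i]}) := 1%:M + v *: map_mx polyC (g - 1%:M).
have ME v z : map_mx (horner_eval z) (M v) = 1%:M + v.[z] *: (g - 1%:M).
  rewrite map_mxD map_mx1 map_mxZ -map_mx_comp; congr (_ + _ *: _).
  by apply/matrixP => i j; rewrite !mxE /= /horner_eval hornerC.
have detE v z : (\det (M v)).[z] = \det (1%:M + v.[z] *: (g - 1%:M)).
  by rewrite -ME det_map_mx.
have [||u [u0 u1 ut]] := @polynomial_path_avoiding (\det (M 'X)).
- by rewrite detE hornerX scale0r addr0 det1 oner_neq0.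
- rewrite detE hornerX scale1r addrC subrK -unitfE -unitmxE.
  by have [] := mulmx1_unit gh.
pose G t := 1%:M + u.[t%:C] *: (g - 1%:M).
have G_unit t : G t \in unitmx by have := ut t; rewrite detE hornerX -unitfE -unitmxE.
exists (fun t => G t *m X *m invmx (G t)); split.
- move=> i j.
  have GE t : G t = map_mx (horner_eval t%:C) (M u) by rewrite ME.
  (* Writing the inverse as adjugate over determinant exhibits each entry as a quotient of
     polynomials in [t]. *)
  have -> : (fun t => (G t *m X *m invmx (G t)) i j) = (fun t =>
      ((M u *m map_mx polyC X *m \adj (M u)) i j).[t%:C] / (\det (M u)).[t%:C]).
    apply/funext => t; rewrite /invmx G_unit -scalemxAr mxE mulrC detE -/(G t).
    have XE : X = map_mx (horner_eval t%:C) (map_mx polyC X).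
      by apply/matrixP => k l; rewrite !mxE /= /horner_eval hornerC.
    by congr (_ / _); rewrite GE {1}XE -map_mx_adj -!map_mxM mxE.
  apply: continuous_horner_fraction; first exact: continuous_real_complex.
  by move=> t; rewrite detE -unitfE -unitmxE; exact: G_unit.
- have G0 : G 0 = 1%:M by rewrite /G rmorph0 u0 scale0r addr0.
  by rewrite G0 invmx1 mul1mx mulmx1.
- have G1 : G 1 = g by rewrite /G rmorph1 u1 scale1r addrC subrK.
  have [g_unit _] := mulmx1_unit gh.
  by rewrite G1; congr (_ *m _); rewrite -[LHS]mulmx1 -gh mulmxA mulVmx ?mul1mx.
- move=> t; rewrite /mxroots /= (expmx_conj _ _ (mulVmx _) (mulmxV _)) // XA.
  have -> : G t *m A = A *m G t.
    rewrite mulmxDl mulmxDr mulmx1 mul1mx -scalemxAl -scalemxAr mulmxBl mulmxBr.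
    by rewrite gA mul1mx mulmx1.
  by rewrite mulmxK.
Qed.

Lemma joined_line n (S : set 'M[R[i]]_n) X D :
  (forall t, S (X + t *: D)) -> joined S X (X + D).
Proof.
move=> SXD; exists (fun t => X + t%:C *: D); split=> //.
- move=> i j; rewrite (_ : (fun t => _) = fun t : R => X i j + t%:C * D i j).
    move=> t; apply: cvgD; first exact: cvg_cst.
    by apply: cvgM; [exact: continuous_real_complex|exact: cvg_cst].
  by apply/funext => t; rewrite !mxE.
- by rewrite scale0r addr0.
- by rewrite scale1r.
Qed.

Lemma joined_root_chain n p (A X Y : 'M[R[i]]_n) :
  root_chain p A X Y -> X ^+ p = A -> joined (mxroots p A) X Y.
Proof.
(* Chains may be traversed backwards, so being a root has to be carried in both directions through
   the induction. *)
suff H : root_chain p A X Y -> (X ^+ p = A <-> Y ^+ p = A) /\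
    (X ^+ p = A -> joined (mxroots p A) X Y) by move=> /H[].
elim=> {X Y} [X Y st|X|X Y _ [XY IH]|X Y Z _ [XY IHX] _ [YZ IHY]].
- have j : joined (mxroots p A) X Y.
    case: st => [g h {}X XA gh gA|{}X D XD]; first exact: joined_centralizer.
    exact: joined_line.
  by split=> //; case: j => f [_ <- <- Sf]; split=> _; exact: Sf.
- split=> // XA; exists (fun=> X); split=> // i j; exact: cst_continuous.
- by split; [tauto|move=> /XY/IH; apply: joined_sym].
- split; first tauto; move=> XA; apply: joined_trans (IHX XA) (IHY _); tauto.
Qed.

End RootPaths.

Theorem theorem2 (R : realType) (p n : nat) (hp : (0 < p)%N) (hn : (0 < n)%N)
    (A : 'M[R[i]]_n) (hA : nilpotent_mx A) :
  path_connected R (mxroots p A).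
Proof.
move=> X Y; rewrite /mxroots /= => XA YA.
have [k Ak] := hA.
have nilX (Z : 'M[R[i]]_n) : Z ^+ p = A -> Z ^+ (p * k) = 0 by move=> ZA; rewrite exprM ZA.
have chain : root_chain p A X Y.
  by rewrite -YA; apply: (root_chain_nilp hp _ (nilX _ XA) (nilX _ YA)); rewrite XA.
have [f [cf f0 f1 Sf]] := joined_root_chain chain XA.
exists f; split=> [|||t _]; [|exact: f0|exact: f1|exact: Sf].
by apply: continuous_subspaceT; apply: continuous_mx.
Qed.
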